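(* Every linearly ordered set $I$ can be embedded in an extremely symmetrically complete ordered set $J$.
   Context: Ordered sets are linearly ordered, and embeddings are order preserving. A cut in a linearly ordered set $J$ is a pair $(D,E)$ of nonempty subsets with $J=D\cup E$ and $d<e$ for all $d\in D$, $e\in E$. Its cofinality is $(\kappa,\lambda)$ with $\kappa=\mathrm{cf}(D)$ the cofinality of $D$ and $\lambda=\mathrm{ci}(E)$ the coinitiality of $E$ (cofinality under the reversed ordering); these equal $1$ when $D$ has a maximum, resp. $E$ has a minimum. The cut is strongly asymmetric if $\kappa\ne\lambda$ and at least one of $\kappa,\lambda$ is uncountable. $J$ is extremely symmetrically complete if every cut in $J$ is strongly asymmetric and both the coinitiality and the cofinality of $J$ are uncountable. *)

(* Defs.v *)
From HB Require Import structures.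
From mathcomp Require Import all_boot all_order.
From mathcomp Require Import boolp classical_sets functions cardinality.

Set Implicit Arguments.
Unset Strict Implicit.
Unset Printing Implicit Defensive.

Import Order.TTheory.

Local Open Scope order_scope.
Local Open Scope card_scope.
Local Open Scope classical_set_scope.

Definition cofinal_in (d : Order.disp_t) (T : orderType d) (D K : set T) : Prop :=
  K `<=` D /\ forall x, D x -> exists2 y, K y & x <= y.

(* Cardinals are represented by sets, compared with #= and #<=. [cofinality D K]
   means that cf(D) is the cardinality of K: K is a cofinal subset of D of least
   cardinality. Such a K is unique up to #=, and is a singleton exactly when D
   has a maximum. *)
Definition cofinality (d : Order.disp_t) (T : orderType d) (D K : set T) : Prop :=
  cofinal_in D K /\ forall K' : set T, cofinal_in D K' -> K #<= K'.

Definition coinitiality (d : Order.disp_t) (T : orderType d) (E L : set T) : Prop :=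
  @cofinality _ T^d E L.

Definition is_cut (d : Order.disp_t) (T : orderType d) (D E : set T) : Prop :=
  [/\ D !=set0, E !=set0, [set: T] = D `|` E &
      forall x y, D x -> E y -> x < y].

Definition cut_cofinality (d : Order.disp_t) (T : orderType d)
    (D E K L : set T) : Prop :=
  cofinality D K /\ coinitiality E L.

Definition strongly_asymmetric (d : Order.disp_t) (T : orderType d)
    (D E : set T) : Prop :=
  exists K L : set T,
    [/\ cut_cofinality D E K L, ~ (K #= L) & ~ countable K \/ ~ countable L].

Definition extremely_symmetrically_complete (d : Order.disp_t)
    (T : orderType d) : Prop :=
  [/\ forall D E : set T, is_cut D E -> strongly_asymmetric D E,
      exists2 L : set T, coinitiality [set: T] L & ~ countable L &
      exists2 K : set T, cofinality [set: T] K & ~ countable K].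

(* Main.v *)
(* A set is eta_1 if any two countable subsets A < B, possibly empty, are
   strictly separated by a point. The ultrapower of the lexicographic product of
   I and the rationals over a free ultrafilter on nat is eta_1, and I embeds in
   it. Being eta_1, it has points and ends of uncountable character only, and no
   gap both of whose sides have countable cofinality. Fill by one point each gap
   both of whose sides have uncountable cofinality. The result is still eta_1,
   and each of its cuts has a countable cofinal (or coinitial) set on one side,
   hence by eta_1 on exactly one side, so the cut is strongly asymmetric. *)

Require Import Defs.
From HB Require Import structures.
From mathcomp Require Import all_boot all_order.
From mathcomp Require Import ssralg ssrnum rat lra.
From mathcomp Require Import boolp classical_sets functions cardinality filter.

Set Implicit Arguments.
Unset Strict Implicit.
Unset Printing Implicit Defensive.

Import Order.TTheory GRing.Theory Num.Theory.

Local Open Scope order_scope.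
Local Open Scope card_scope.
Local Open Scope classical_set_scope.

(* Maximal family of choice functions on F with pairwise disjoint graphs: by
   maximality its values at some A in F exhaust A, and its values at any B in F
   are pairwise distinct. *)
Lemma ex_least_card (T : Type) (F : set (set T)) :
  F !=set0 -> exists2 A, F A & forall B, F B -> A #<= B.
Proof.
move=> [A0 FA0].
have [F0|nF0] := pselect (F set0); first by exists set0.
have [t0 _] : A0 !=set0 by apply/set0P/eqP => A00; apply: nF0; rewrite -A00.
pose D := [set g : set T -> T | forall A, F A -> A (g A)].
pose graph (g : set T -> T) := [set p : set T * T | F p.1 /\ g p.1 = p.2].
have [E [ED tE maxE]] := ex_maximal_disjoint_subcollection graph D.
have [[A FA EA]|noA] :=
    pselect (exists2 A, F A & A `<=` (fun g : set T -> T => g A) @` E).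
  exists A => // B FB; apply: (card_le_trans (subset_card_le EA)).
  apply: (card_le_trans (card_image_le _ _)).
  have Einj : {in E &, injective (fun g : set T -> T => g B)}.
    move=> g h /set_mem Eg /set_mem Eh gh; apply: tE => //.
    by exists (B, g B).
  rewrite -(card_le_eql (inj_card_eq Einj)).
  by apply: subset_card_le => _ [g Eg <-]; exact: (ED _ Eg).
have /choice[h hP] A :
    exists x, F A -> A x /\ forall g : set T -> T, E g -> g A <> x.
  have [FA|nFA] := pselect (F A); last by exists t0.
  apply: contrapT => nox; apply: noA; exists A => // x Ax.
  apply: contrapT => nEx; apply: nox; exists x => _; split=> // g Eg gx.
  by apply: nEx; exists g.
have hE : ~ E h by move=> Eh; have [_ /(_ _ Eh)] := hP _ FA0.
exfalso; apply: (maxE (E `|` [set h])).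
- split; first exact: subsetUl.
  by move=> sub; apply: hE; apply: sub; right.
- by move=> g [/ED//|->] A /hP[].
move=> g k [Eg|->] [Ek|->] [[A x] [[/= FA gx] [/= _ kx]]] //.
- by apply: tE => //; exists (A, x).
- by have [_ /(_ _ Eg)] := hP _ FA; rewrite gx kx.
- by have [_ /(_ _ Ek)] := hP _ FA; rewrite gx kx.
Qed.

(** * Eta_1 relations and the cofinalities of cuts *)

(** A bare relation is used so as to cover both linear orders and the strict part of a preorder. *)
Definition eta1 (T : Type) (lt : T -> T -> Prop) : Prop :=
  forall A B : set T, countable A -> countable B ->
    (forall a b, A a -> B b -> lt a b) ->
    exists z, (forall a, A a -> lt a z) /\ (forall b, B b -> lt z b).

Lemma ex_cofinality d (T : orderType d) (D : set T) : exists K, cofinality D K.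
Proof.
have [|K KD Kmin] := @ex_least_card T (cofinal_in D); last by exists K.
by exists D; split=> // x Dx; exists x.
Qed.

Lemma eta1_uncountable_cofinality d (T : orderType d) (K : set T) :
  eta1 (fun x y : T => x < y) -> cofinality [set: T] K -> ~ countable K.
Proof.
move=> sat [[_ cofK] _] cK; have [//|z [Kz _]] := sat K set0 cK (countable0 _).
by have [y /Kz yz] := cofK z I; rewrite leNgt yz.
Qed.

Lemma eta1_dual d (T : orderType d) :
  eta1 (fun x y : T => x < y) -> eta1 (fun x y : T^d => x < y).
Proof.
move=> sat A B cA cB AB; have [|z [Bz zA]] := sat B A cB cA; last by exists z.
by move=> b a Bb Aa; exact: AB.
Qed.

(** A point strictly between [K] and [L] could lie neither in [D] nor in [E]. *)
Lemma eta1_cut_uncountable d (T : orderType d) (D E K L : set T) :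
  eta1 (fun x y : T => x < y) -> is_cut D E ->
  cofinal_in D K -> @cofinal_in _ T^d E L -> countable K -> ~ countable L.
Proof.
move=> sat [_ _ DE ltDE] [KD cofK] [LE coiL] cK cL.
have [|z [Kz zL]] := sat K L cK cL.
  by move=> a b Ka Lb; apply: ltDE; [exact: KD|exact: LE].
have : (D `|` E) z by rewrite -DE.
case=> [/cofK[y /Kz yz zy]|/coiL[y /zL zy]].
  by move: (lt_le_trans yz zy); rewrite ltxx.
by rewrite leEdual leNgt zy.
Qed.

(** By leastness the second hypothesis makes [K] or [L] countable, and eta_1 forbids both; a
    countable and an uncountable set are not equipotent. *)
Lemma eta1_extremely_symmetrically_complete d (T : orderType d) :
  eta1 (fun x y : T => x < y) ->
  (forall D E : set T, is_cut D E ->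
    (exists2 K, countable K & cofinal_in D K) \/
    (exists2 L, countable L & @cofinal_in _ T^d E L)) ->
  extremely_symmetrically_complete T.
Proof.
move=> sat cuts; split.
- move=> D E cutDE; have [K cofK] := ex_cofinality D.
  have [L coiL] := @ex_cofinality _ T^d E.
  have KL := eta1_cut_uncountable sat cutDE cofK.1 coiL.1.
  exists K, L; split=> //.
    move=> eqKL; have [cK|cL] : countable K \/ countable L.
    + case: (cuts _ _ cutDE) => [[K' cK' /cofK.2 KK']|[L' cL' /coiL.2 LL']].
        by left; exact: card_le_trans cK'.
      by right; exact: card_le_trans cL'.
    + by apply: (KL cK); rewrite -(eq_countable eqKL).
    + by apply: (KL _ cL); rewrite (eq_countable eqKL).
  by apply: contrapT => /not_orP[/contrapT cK /contrapT cL]; exact: KL cK cL.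
- have [L coiL] := @ex_cofinality _ T^d [set: T]; exists L => //.
  exact: eta1_uncountable_cofinality (eta1_dual sat) coiL.
- have [K cofK] := ex_cofinality [set: T]; exists K => //.
  exact: eta1_uncountable_cofinality sat cofK.
Qed.

(** * Filling the gaps of an eta_1 preorder by lower sets *)

(** With a preorder the ultrapower needs no quotient: equivalent points generate the same lower set,
    so the filling identifies them. *)
Record eta1Preorder := Eta1Preorder {
  carrier :> Type;
  ple : carrier -> carrier -> Prop;
  ple_total : forall x y, ple x y \/ ple y x;
  ple_trans : forall y x z, ple x y -> ple y z -> ple x z;
  plt_eta1 : eta1 (fun x y => ~ ple y x) }.

Definition plt (P : eta1Preorder) (x y : P) : Prop := ~ ple y x.

Section GapFilling.
Variable P : eta1Preorder.
Implicit Types (x y z : P) (A B D : set P).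

Lemma ple_refl x : ple x x.
Proof. by case: (ple_total x x). Qed.

Lemma plt_ple_trans x y z : plt x y -> ple y z -> plt x z.
Proof. by move=> xy yz zx; apply: xy; exact: ple_trans zx. Qed.

(* The retained lower sets are those generated by a point, and the gaps of
   uncountable cofinality on both sides; filling a gap with a countable side
   would create a cut with countable cofinalities. *)
Definition retained D : Prop :=
  [/\ forall x y, ple x y -> D y -> D x,
      forall B, countable B -> (forall b, B b -> ~ D b) ->
        exists2 y, ~ D y & forall b, B b -> plt y b &
      (exists2 m, D m & forall x, D x -> ple x m) \/
      (forall A, countable A -> A `<=` D ->
        exists2 y, D y & forall a, A a -> plt a y)].

Definition filling : Type := {D : set P | retained D}.

HB.instance Definition _ := gen_eqMixin filling.
HB.instance Definition _ := gen_choiceMixin filling.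

Fact filling_display : Order.disp_t.
Proof. exact: Order.Disp. Qed.

Definition filling_le (X Y : filling) : bool := `[< sval X `<=` sval Y >].

Lemma filling_le_refl : reflexive filling_le.
Proof. by move=> X; apply/asboolP. Qed.

Lemma filling_le_anti : antisymmetric filling_le.
Proof.
move=> [X rX] [Y rY] /andP[/asboolP/= XY /asboolP/= YX].
exact/eq_exist/seteqP.
Qed.

Lemma filling_le_trans : transitive filling_le.
Proof.
move=> Y X Z /asboolP XY /asboolP YZ; apply/asboolP.
exact: subset_trans XY YZ.
Qed.

HB.instance Definition _ := Order.Le_isPOrder.Build filling_display filling
  filling_le_refl filling_le_anti filling_le_trans.

Lemma filling_le_total : total (<=%O : rel filling).
Proof.
move=> X Y; apply/orP; have [XY|nXY] := pselect (sval X `<=` sval Y).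
  by left; apply/asboolP.
right; apply/asboolP => y Yy; apply: contrapT => nXy; apply: nXY => x Xx.
have [downX _ _] := svalP X; have [downY _ _] := svalP Y.
by case: (ple_total x y) => [/downY|/downX]; [apply|move/(_ Xx)].
Qed.

HB.instance Definition _ :=
  Order.POrder_isTotal.Build filling_display filling filling_le_total.

Implicit Types X Y Z : filling.

Lemma filling_leP X Y : reflect (sval X `<=` sval Y) (X <= Y).
Proof. exact: asboolP. Qed.

Lemma filling_ltP X Y : reflect (exists2 y, sval Y y & ~ sval X y) (X < Y).
Proof.
rewrite ltNge; apply: (iffP negP) => [nYX|[y Yy nXy] YX].
  have /existsNP[y /not_implyP[Yy nXy]] : ~ (sval Y `<=` sval X).
    by move/filling_leP.
  by exists y.
by move/filling_leP : YX => /(_ _ Yy).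
Qed.

Lemma retained_principal x : retained [set y | ple y x].
Proof.
split=> [y z yz|B cB Bx|]; first exact: ple_trans yz.
  have [|z [xz zB]] := plt_eta1 (countable1 x) cB.
    by move=> _ b -> /Bx.
  by exists z => //; exact: xz.
by left; exists x => //; exact: ple_refl.
Qed.

Definition principal x : filling := exist _ _ (retained_principal x).

Lemma principal_le x y : (principal x <= principal y) <-> ple x y.
Proof.
split=> [/filling_leP|xy]; first by apply; exact: ple_refl.
by apply/filling_leP => z /= zx; exact: ple_trans xy.
Qed.

Lemma principal_lt x y : (principal x < principal y) <-> plt x y.
Proof.
rewrite ltNge; split=> [/negP + yx|xy]; first by apply; exact/principal_le.
by apply/negP => /principal_le.
Qed.

Lemma principal_gt X x : ~ sval X x -> X < principal x.
Proof. by move=> Xx; apply/filling_ltP; exists x => //; exact: ple_refl. Qed.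

(** Picking a point of [Y] outside [X] for each [Y] in [B] gives a countable set outside [X]; the
    second clause of [retained] provides a point outside [X] strictly below it. *)
Lemma filling_between_above X (B : set filling) : countable B ->
  (forall Y, B Y -> X < Y) ->
  exists2 x, X < principal x & forall Y, B Y -> principal x < Y.
Proof.
move=> cB XB; have [_ gapX _] := svalP X.
have /choice[b bP] Y : exists b, B Y -> sval Y b /\ ~ sval X b.
  have [/XB/filling_ltP[b Yb Xb]|nBY] := pselect (B Y); first by exists b.
  (* Default value off [B]: eta_1 for two empty sets yields a point of [P]. *)
  have [z _] := plt_eta1 (countable0 P) (countable0 P) (fun _ _ => False_ind _).
  by exists z.
have [||y Xy yb] := gapX (b @` B).
- exact: card_le_trans (card_image_le _ _) cB.
- by move=> _ [Y BY <-]; exact: (bP _ BY).2.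
exists y; first exact: principal_gt.
move=> Y BY; apply/filling_ltP; exists (b Y); first exact: (bP _ BY).1.
by apply: yb; exists Y.
Qed.

Lemma filling_dense X Y : X < Y -> exists2 x, X < principal x & principal x < Y.
Proof.
move=> XY; have [|x Xx xY] := @filling_between_above X _ (countable1 Y).
  by move=> _ ->.
by exists x => //; exact: xY.
Qed.

(** Density replaces each [X] in [A] by a point [c X] with [principal (c X)] between [X] and [Y]. If
    [Y] has a maximum, eta_1 separates these points from it; otherwise the last clause of [retained]
    bounds them inside [Y]. *)
Lemma filling_between_below Y (A : set filling) : countable A ->
  (forall X, A X -> X < Y) ->
  exists2 x, principal x < Y & forall X, A X -> X < principal x.
Proof.
move=> cA AY; have [downY gapY maxY] := svalP Y.
have /choice[c cP] X : exists c, A X -> X < principal c /\ principal c < Y.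
  have [/AY/filling_dense[c]|nAX] := pselect (A X); first by exists c.
  by have [z _] := gapY _ (countable0 P) (fun _ => False_ind _); exists z.
have cY X : A X -> sval Y (c X).
  by case/cP => _ /ltW /filling_leP; apply; exact: ple_refl.
have cc : countable (c @` A) by exact: card_le_trans (card_image_le _ _) cA.
have lt_c X z : A X -> plt (c X) z -> X < principal z.
  by move=> AX cz; apply: lt_trans (cP _ AX).1 _; exact/principal_lt.
case: maxY => [[m Ym mmax]|unbY].
  have [|z [cz zm]] := plt_eta1 cc (countable1 m).
    move=> _ _ [X AX <-] ->; have /filling_ltP[y Yy ycX] := (cP _ AX).2.
    exact: plt_ple_trans ycX (mmax _ Yy).
  have zm' : plt z m by exact: zm.
  exists z; first by apply/filling_ltP; exists m.
  by move=> X AX; apply: lt_c => //; apply: cz; exists X.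
have [|z Yz cz] := unbY _ cc; first by move=> _ [X /cY Yc <-].
(* A point of [Y] strictly above [z] makes [principal z < Y] strict. *)
have [|y Yy zy] := unbY _ (countable1 z); first by move=> _ ->.
exists z; first by apply/filling_ltP; exists y => //; exact: zy.
by move=> X AX; apply: lt_c => //; apply: cz; exists X.
Qed.

(** Points [a X] are inserted between each [X] in [A] and all of [B], then points [b Y] between all
    the [a X] and each [Y] in [B]; eta_1 of [P] separates the two countable families. *)
Lemma filling_eta1 : eta1 (fun X Y : filling => X < Y).
Proof.
move=> A B cA cB AB.
have [z0 _] := plt_eta1 (countable0 P) (countable0 P) (fun _ _ => False_ind _).
have /choice[a aP] X : exists a, A X ->
    X < principal a /\ forall Y, B Y -> principal a < Y.
  have [AX|nAX] := pselect (A X); last by exists z0.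
  by have [|a] := @filling_between_above X _ cB; [move=> Y; exact: AB|exists a].
have ca : countable (a @` A) by exact: card_le_trans (card_image_le _ _) cA.
have /choice[b bP] Y : exists b, B Y ->
    principal b < Y /\ forall X, A X -> plt (a X) b.
  have [BY|nBY] := pselect (B Y); last by exists z0.
  have [||b bY bA] := @filling_between_below Y (principal @` (a @` A)).
  - exact: card_le_trans (card_image_le _ _) ca.
  - by move=> _ [_ [X AX <-] <-]; exact: (aP _ AX).2.
  exists b => _; split=> // X AX; apply/principal_lt.
  by apply: bA; exists (a X) => //; exists X.
have [||z [az zb]] := plt_eta1 ca (B := b @` B).
- exact: card_le_trans (card_image_le _ _) cB.
- by move=> _ _ [X AX <-] [Y BY <-]; exact: (bP _ BY).2.
exists (principal z); split=> [X AX|Y BY].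
  by apply: lt_trans (aP _ AX).1 _; apply/principal_lt/az; exists X.
by apply: lt_trans _ (bP _ BY).1; apply/principal_lt/zb; exists Y.
Qed.

(** Otherwise the points whose principal lower set is in [D] form a gap of [P] with both sides of
    uncountable character. This gap is retained, so it is an element of the filling, yet it fits on
    neither side of the cut. *)
Lemma filling_cut (D E : set filling) : is_cut D E ->
  (exists2 K, countable K & cofinal_in D K) \/
  (exists2 L, countable L & @cofinal_in _ filling^d E L).
Proof.
move=> [_ _ DE ltDE]; apply: contrapT => /not_orP[noK noL].
have inDE X : D X \/ E X by have : (D `|` E) X by rewrite -DE.
have downD X Y : X <= Y -> D Y -> D X.
  by move=> XY DY; case: (inDE X) => // /(ltDE _ _ DY); rewrite ltNge XY.
have upE X Y : X <= Y -> E X -> E Y.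
  by move=> XY EX; case: (inDE Y) => // /ltDE /(_ EX); rewrite ltNge XY.
have DnE X : D X -> ~ E X by move=> DX /(ltDE _ _ DX); rewrite ltxx.
have unbD (K : set filling) : countable K -> K `<=` D ->
    exists2 Y, D Y & forall X, K X -> X < Y.
  move=> cK KD; apply: contrapT => noY; apply: noK; exists K => //.
  split=> // X DX.
  apply: contrapT => noZ; apply: noY; exists X => // Z KZ.
  by rewrite ltNge; apply/negP => XZ; apply: noZ; exists Z.
have unbE (L : set filling) : countable L -> L `<=` E ->
    exists2 Y, E Y & forall X, L X -> Y < X.
  move=> cL LE; apply: contrapT => noY; apply: noL; exists L => //.
  split=> // X EX.
  apply: contrapT => noZ; apply: noY; exists X => // Z LZ.
  by rewrite ltNge; apply/negP => XZ; apply: noZ; exists Z.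
have unbD1 X : D X -> exists2 Y, D Y & X < Y.
  move=> DX; have [|Y DY XY] := unbD _ (countable1 X); first by move=> _ ->.
  by exists Y => //; exact: XY.
have unbE1 X : E X -> exists2 Y, E Y & Y < X.
  move=> EX; have [|Y EY YX] := unbE _ (countable1 X); first by move=> _ ->.
  by exists Y => //; exact: YX.
have cpr (A : set P) : countable A -> countable (principal @` A).
  by move=> cA; exact: card_le_trans (card_image_le _ _) cA.
pose D0 := [set x | D (principal x)].
have nD0 x : ~ D0 x -> E (principal x) by case: (inDE (principal x)).
have rD0 : retained D0.
  split=> [x y xy|B cB BD0|]; first exact/downD/principal_le.
    have [|Y EY YB] := unbE _ (cpr _ cB); first by move=> _ [b /BD0/nD0 + <-].
    (* A second descent inside [E] leaves room for a principal element, which is in [E] because it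
       lies above [Z]. *)
    have [Z EZ /filling_dense[z Zz zY]] := unbE1 _ EY.
    exists z; first by move=> /DnE; apply; exact: upE (ltW Zz) EZ.
    move=> b Bb; apply/principal_lt; apply: lt_trans zY _.
    by apply: YB; exists b.
  right=> A cA AD0; have [|Y DY AY] := unbD _ (cpr _ cA).
    by move=> _ [a /AD0 + <-].
  have [Z DZ /filling_dense[z Yz zZ]] := unbD1 _ DY.
  exists z; first exact: downD (ltW zZ) DZ.
  move=> a Aa; apply/principal_lt; apply: lt_trans Yz.
  by apply: AY; exists a.
pose X : filling := exist _ D0 rD0.
(* Neither [D] nor [E] has an extremum, so a principal element fits strictly between [X] and some
   [Z] on the same side; this contradicts the definition of [D0]. *)
case: (inDE X) => [/unbD1[Z DZ /filling_dense[z Xz zZ]]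
                  |/unbE1[Z EZ /filling_dense[z Zz zX]]].
  have /filling_ltP[y yz Xy] := Xz; apply: Xy.
  by apply: downD DZ; apply: le_trans (ltW zZ); exact/principal_le.
have /ltW/filling_leP/(_ z (ple_refl z)) Dz := zX.
by apply: (DnE _ Dz); exact: upE (ltW Zz) EZ.
Qed.

Lemma filling_extremely_symmetrically_complete :
  extremely_symmetrically_complete filling.
Proof.
exact: eta1_extremely_symmetrically_complete filling_eta1 filling_cut.
Qed.

End GapFilling.

(** * Separating finite sets in a dense order without endpoints *)

Lemma finite_set_max d (T : orderType d) (A : set T) : finite_set A ->
  A = set0 \/ exists2 m, A m & forall a, A a -> a <= m.
Proof.
move=> /finite_seqP[s ->]; elim: s => [|x s IHs].
  by left; rewrite -subset0.
right; case: IHs => [s0|[m sm mmax]].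
  exists x => [|a] /=; first exact: mem_head.
  by rewrite inE => /orP[/eqP->//|sa]; have : [set` s] a by []; rewrite s0.
have [xm|mx] := leP x m.
  exists m => [|a] /=; first by rewrite inE [m \in s]sm orbT.
  by rewrite inE => /orP[/eqP->//|/mmax].
exists x => [|a] /=; first exact: mem_head.
by rewrite inE => /orP[/eqP->//|/mmax am]; exact: le_trans (ltW mx).
Qed.

Lemma finite_set_min d (T : orderType d) (A : set T) : finite_set A ->
  A = set0 \/ exists2 m, A m & forall a, A a -> m <= a.
Proof. exact: (@finite_set_max _ T^d). Qed.

Lemma finite_separation d (T : orderType d) (A B : set T) :
  T -> (forall x : T, exists y, x < y) -> (forall x : T, exists y, y < x) ->
  (forall x y : T, x < y -> exists2 z, x < z & z < y) ->
  finite_set A -> finite_set B -> (forall a b, A a -> B b -> a < b) ->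
  exists z, (forall a, A a -> a < z) /\ (forall b, B b -> z < b).
Proof.
move=> t0 noMax noMin dense.
move=> /finite_set_max[->|[m Am mmax]] /finite_set_min[->|[n Bn nmin]] AB.
- by exists t0.
- by have [z zn] := noMin n; exists z; split=> // b /nmin; exact: lt_le_trans.
- have [z mz] := noMax m; exists z; split=> // a /mmax am.
  exact: le_lt_trans mz.
have [z mz zn] := dense _ _ (AB _ _ Am Bn); exists z.
split=> [a /mmax am|b /nmin nb].
  exact: le_lt_trans mz.
exact: lt_le_trans nb.
Qed.

(** * The lexicographic product with the rationals *)

Lemma lexi_rat_lt d (I : orderType d) (x y : I *lexi[d] rat) :
  (x < y) = (x.1 < y.1) || (x.1 == y.1) && (x.2 < y.2).
Proof.
case: x y => [i p] [j q]; rewrite ltxi_pair /=.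
by case: (ltgtP i j).
Qed.

Section LexiRat.
Variables (d : Order.disp_t) (I : orderType d).
Local Notation M := (I *lexi[d] rat).

Lemma lexi_rat_no_max (x : M) : exists y : M, x < y.
Proof.
exists ((x.1, x.2 + 1)%R : M).
by rewrite lexi_rat_lt /= eqxx /= ltrDl orbT.
Qed.

Lemma lexi_rat_no_min (x : M) : exists y : M, y < x.
Proof.
exists ((x.1, x.2 - 1)%R : M).
by rewrite lexi_rat_lt /= eqxx /= gtrBl orbT.
Qed.

Lemma lexi_rat_dense (x y : M) : x < y -> exists2 z : M, x < z & z < y.
Proof.
rewrite lexi_rat_lt => /orP[xy|/andP[/eqP xy lt2]].
  (* When the first coordinates differ, moving up inside the copy of the rationals over [x.1] stays
     below [y]. *)
  exists ((x.1, x.2 + 1)%R : M); rewrite lexi_rat_lt /=; last by rewrite xy.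
  by rewrite eqxx /= ltrDl orbT.
have [z xz zy] : exists2 z : rat, (x.2 < z)%R & (z < y.2)%R.
  by exists ((x.2 + y.2) / 2)%R; lra.
by exists ((x.1, z) : M); rewrite lexi_rat_lt /= ?xz ?zy ?xy eqxx orbT.
Qed.

End LexiRat.

(** * The ultrapower over a free ultrafilter on [nat] *)

Section Ultrapower.
Variables (d : Order.disp_t) (M : orderType d) (U : set_system nat).
Context (ultraU : UltraFilter U).
Hypothesis freeU : forall n, U [set i | (n <= i)%N].
Hypothesis sepM : forall A B : set M, finite_set A -> finite_set B ->
  (forall a b, A a -> B b -> a < b) ->
  exists z, (forall a, A a -> a < z) /\ (forall b, B b -> z < b).

Definition ultra_le (x y : nat -> M) : Prop := U [set i | x i <= y i].

Lemma ultra_ltP (x y : nat -> M) : ~ ultra_le y x <-> U [set i | x i < y i].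
Proof.
split=> [nyx|Ult Ule].
  have [//|] := in_ultra_setVsetC [set i | y i <= x i] ultraU.
  by apply: filterS => i /negP; rewrite -ltNge.
have [i [/= xy yx]] := filter_ex (filterI Ult Ule).
by move: xy; rewrite ltNge yx.
Qed.

Lemma ultra_le_total x y : ultra_le x y \/ ultra_le y x.
Proof.
have [|/ultra_ltP Uyx] := pselect (ultra_le x y); first by left.
by right; apply: filterS Uyx => i /ltW.
Qed.

Lemma ultra_le_trans y x z : ultra_le x y -> ultra_le y z -> ultra_le x z.
Proof.
by move=> xy yz; apply: filterS (filterI xy yz) => i [/=]; exact: le_trans.
Qed.

Lemma filter_finite_bigcap (J : Type) (D : set J) (f : J -> set nat) :
  finite_set D -> (forall j, D j -> U (f j)) ->
  U [set i | forall j, D j -> f j i].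
Proof.
(* This equips the bare type [J] with the choice structure that finite sets over it require. *)
elim/Pchoice: J => J in D f *.
move=> /finite_fsetP[X ->] Uf.
exact: filterS (@filter_bigI _ _ X f U _ Uf).
Qed.

Lemma finite_preimage_ltn (J : Type) (D : set J) (f : J -> nat) n :
  {in D &, injective f} -> finite_set [set j | D j /\ (f j < n)%N].
Proof.
move=> finj.
have finj' : {in [set j | D j /\ (f j < n)%N] &, injective f}.
  by move=> j k /set_mem[Dj _] /set_mem[Dk _]; apply: finj; exact/mem_set.
rewrite -(eq_finite_set (inj_card_eq finj')).
by apply: sub_finite_set (finite_II n) => _ [j [_ fj] <-].
Qed.

(** Diagonal argument: at coordinate [i] only the finite stages [A_ n], [B_ n] with [n <= i] that
    are correctly ordered at [i] are separated. Each stage is correctly ordered on a set of [U], and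
    freeness supplies [n <= i]. *)
Lemma ultra_eta1 : eta1 (fun x y => ~ ultra_le y x).
Proof.
move=> A B /countable_injP[f finj] /countable_injP[g ginj] AB.
pose A_ n := [set a | A a /\ (f a < n)%N].
pose B_ n := [set b | B b /\ (g b < n)%N].
pose X n := [set i | forall a b, A_ n a -> B_ n b -> a i < b i].
have UX n : U (X n).
  have fin :=
    finite_setX (finite_preimage_ltn n finj) (finite_preimage_ltn n ginj).
  pose F (p : (nat -> M) * (nat -> M)) := [set i | p.1 i < p.2 i].
  apply: filterS (filter_finite_bigcap fin (f := F) _).
    by move=> i Xi a b Aa Bb; exact: (Xi (a, b)).
  by move=> [a b] [[/= Aa _] [Bb _]]; apply/ultra_ltP; exact: AB.
have sub_X m n : (m <= n)%N -> X n `<=` X m.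
  move=> mn i Xi a b [Aa fa] [Bb gb].
  by apply: Xi; split=> //; exact: leq_trans mn.
pose Ai i :=
  [set a i | a in [set a | exists n, [/\ (n <= i)%N, X n i & A_ n a]]].
pose Bi i :=
  [set b i | b in [set b | exists n, [/\ (n <= i)%N, X n i & B_ n b]]].
have /choice[z zP] i : exists z,
    (forall a, Ai i a -> a < z) /\ (forall b, Bi i b -> z < b).
  apply: sepM.
  - apply: finite_image; apply: sub_finite_set (finite_preimage_ltn i finj).
    by move=> a [n [ni _ [Aa fa]]]; split=> //; exact: leq_trans ni.
  - apply: finite_image; apply: sub_finite_set (finite_preimage_ltn i ginj).
    by move=> b [n [ni _ [Bb gb]]]; split=> //; exact: leq_trans ni.
  - move=> _ _ [a [m [_ Xm [Aa fa]]] <-] [b [n [_ Xn [Bb gb]]] <-].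
    (* The larger of the two stages contains both [a] and [b]. *)
    have [mn|/ltnW nm] := leqP m n.
      by apply: Xn; split=> //; exact: leq_trans mn.
    by apply: Xm; split=> //; exact: leq_trans nm.
exists z; split=> [a Aa|b Bb]; apply/ultra_ltP.
  (* The first stage containing [a] is [(f a).+1], the bound in [A_] being strict. *)
  apply: filterS (filterI (freeU (f a).+1) (UX (f a).+1)) => i [/= fai Xi].
  by apply: (zP i).1; exists a => //; exists (f a).+1.
apply: filterS (filterI (freeU (g b).+1) (UX (g b).+1)) => i [/= gbi Xi].
by apply: (zP i).2; exists b => //; exists (g b).+1.
Qed.

Definition ultrapower : eta1Preorder :=
  Eta1Preorder ultra_le_total ultra_le_trans ultra_eta1.

Lemma ultra_le_cst (x y : M) : ultra_le (fun=> x) (fun=> y) <-> x <= y.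
Proof.
split=> [/filter_ex[]//|xy].
by apply: filterS filterT => i _.
Qed.

End Ultrapower.

(** * Embedding by constant sequences *)

Lemma inhabited_embedding d (I : orderType d) : I ->
  exists (d' : Order.disp_t) (J : orderType d') (f : I -> J),
    {mono f : x y / x <= y} /\ extremely_symmetrically_complete J.
Proof.
(* An ultrafilter refining the eventually filter contains every tail of [nat]. *)
move=> i0; have [U [ultraU freeU]] := ultraFilterLemma eventually_filter.
have Ule n : U [set i | (n <= i)%N] by apply: freeU; exists n.
pose M : orderType d := (I *lexi[d] rat)%type.
have sepM := fun A B => @finite_separation _ M A B (i0, 0%R)
  (@lexi_rat_no_max _ I) (@lexi_rat_no_min _ I) (@lexi_rat_dense _ I).
pose P := ultrapower ultraU Ule sepM.
exists filling_display, (filling P).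
exists (fun i => principal (P := P) (fun=> ((i, 0%R) : M))); split.
  move=> i j; have lexi_le : (((i, 0%R) : M) <= (j, 0%R)) = (i <= j).
    by rewrite lexi_pair /= lexx implybT andbT.
  apply/idP/idP; first by move=> /principal_le/ultra_le_cst; rewrite lexi_le.
  by move=> ij; apply/principal_le/ultra_le_cst; rewrite lexi_le.
exact: filling_extremely_symmetrically_complete.
Qed.

Theorem corollary18 (d : Order.disp_t) (I : orderType d) :
  exists (d' : Order.disp_t) (J : orderType d') (f : I -> J),
    {mono f : x y / x <= y} /\ extremely_symmetrically_complete J.
Proof.
have [[i0]|noI] := pselect (inhabited I); first exact: inhabited_embedding.
(* The empty order embeds vacuously into any [J]; one built from [nat] serves. *)
have [d' [J [_ [_ scJ]]]] := inhabited_embedding 0%N.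
exists d', J, (fun i => False_rect J (noI (inhabits i))).
by split=> // i; case: noI.
Qed.
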